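(* Let $A\in\mathbb{R}^{p\times p}$, $B_i\in\mathbb{R}^{p\times q_i}$ and $C_i\in\mathbb{R}^{m_i\times p}$ for $i=1,\dots,\kappa$ (with all $q_i,m_i\ge1$), and let $B=[B_1\ \cdots\ B_\kappa]$. Suppose $C_j\neq 0$ for all $j$. If $B$ is full rank and square (i.e. $\sum_{i=1}^\kappa q_i=p$ and $B\in\mathbb{R}^{p\times p}$ is invertible), then there exists $K\in\mathbb{R}^{p\times p}$ such that $A+BK$ is Schur stable and such that, for all $i,j\in\{1,\dots,\kappa\}$, the integer $k'_{i,j}=\min\{k\ge 0: C_j(A+BK)^kB_i\neq 0\}$ exists and satisfies $k'_{i,j}\le p-1$.
   Context: A real square matrix is Schur stable if all its eigenvalues have modulus strictly less than $1$. *)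

(* Defs.v *)
From HB Require Import structures.
From mathcomp Require Import all_boot all_order all_algebra.
From mathcomp Require Import complex.
From mathcomp Require Import reals.
Set Implicit Arguments.
Unset Strict Implicit.
Unset Printing Implicit Defensive.
Import Order.TTheory GRing.Theory Num.Theory.
Local Open Scope ring_scope.
Local Open Scope complex_scope.

(* The spectrum is taken over R[i]; the norm of R[i] is R[i]-valued, and
   [`|z| < 1] there holds iff the real modulus of z is less than 1. *)
Definition schur_stable (R : rcfType) (n : nat) (M : 'M[R]_n) : Prop :=
  forall z : R[i], eigenvalue (map_mx (real_complex R) M) z -> `|z| < 1.

Definition is_min (P : nat -> Prop) (k : nat) : Prop :=
  P k /\ forall l : nat, P l -> (k <= l)%N.

(* [B_1 ... B_kappa], whose native width is the sum of the block widths,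
   transported to a square matrix along the width equation. *)
Definition square_mxrow (R : Type) (kappa p : nat) (q : 'I_kappa -> nat)
    (hq : (\sum_(i < kappa) q i)%N = p)
    (B : forall i : 'I_kappa, 'M[R]_(p, q i)) : 'M[R]_p :=
  castmx (erefl p, hq) (\mxrow_(i < kappa) B i).

(* Main.v *)
Require Import Defs.
From HB Require Import structures.
From mathcomp Require Import all_boot all_order all_algebra.
From mathcomp Require Import complex.
From mathcomp Require Import reals.
Set Implicit Arguments.
Unset Strict Implicit.
Unset Printing Implicit Defensive.
Import Order.TTheory GRing.Theory Num.Theory.
Local Open Scope ring_scope.

(** Since [B] is invertible, [A + B K] ranges over all square matrices as [K]
    does, so it is enough to find one Schur stable [M] that works for every pair
    [i, j]. A rank one matrix [M = u v] does: [C_j M B_i = (C_j u) (v B_i)] is a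
    column times a row, hence nonzero as soon as both factors are. Each [C_j] is
    nonzero by hypothesis, each [B_i] because the columns of an invertible matrix
    are nonzero; over an infinite field a single [u] avoids the finitely many
    proper subspaces [ker C_j] ([exists_mulmx_neq0]), and dually for [v]. The
    only possibly nonzero eigenvalue of [u v] is the scalar [v u]
    ([schur_stable_rank1]), and scaling [u] makes it smaller than 1.

    Thus the minimum is at most 1, which is at most [p - 1] unless [p = 1]. In
    that case [C_j B_i] is itself a nonzero column times a nonzero row, and the
    minimum is 0. *)

Lemma poly_nonroot (F : numDomainType) (P : {poly F}) :
  P != 0 -> exists t, P.[t] != 0.
Proof.
move=> P0; pose rs : seq F := [seq n%:R | n <- iota 0 (size P)].
have urs : uniq rs.
  by rewrite map_inj_uniq ?iota_uniq // => a b /eqP; rewrite eqr_nat => /eqP.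
have [/(max_poly_roots P0)/(_ urs)|/allPn[t _ Pt]] := boolP (all (root P) rs).
  by rewrite size_map size_iota ltnn.
by exists t.
Qed.

(** The vector is sought on the moment curve [t |-> (1, t, t^2, ...)]: a nonzero
    row of [C i] becomes there a nonzero polynomial in [t], and the product of
    these polynomials has a nonroot. *)
Lemma exists_mulmx_neq0 (F : numFieldType) (n : nat) (I : finType)
    (m : I -> nat) (C : forall i, 'M[F]_(m i, n)) :
  (forall i, C i != 0) -> exists u : 'cV[F]_n, forall i, C i *m u != 0.
Proof.
move=> C0.
have /fin_all_exists[r rP] i : exists r, row r (C i) != 0.
  have /matrix0Pn[a [b Cab]] := C0 i; exists a.
  by apply: contraNneq Cab => /rowP/(_ b); rewrite !mxE => ->.
have P0 : \prod_i rVpoly (row (r i) (C i)) != 0.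
  apply/prodf_neq0 => i _; apply: contraNneq (rP i) => ri0.
  by rewrite -[row _ _]rVpolyK ri0 linear0.
have [t] := poly_nonroot P0; rewrite horner_prod => /prodf_neq0 Pt.
exists (\col_k t ^+ k) => i; apply: contraNneq (Pt i isT).
move=> /matrixP/(_ (r i) 0); rewrite !mxE => <-.
rewrite (horner_coef_wide _ (size_poly _ _)); apply/eqP/eq_bigr => k _.
by rewrite coef_rVpoly_ord !mxE.
Qed.

Lemma mulmx_col_row_neq0 (F : idomainType) (m n : nat)
    (u : 'cV[F]_m) (v : 'rV[F]_n) : u != 0 -> v != 0 -> u *m v != 0.
Proof.
move=> /matrix0Pn[a [b]]; rewrite (ord1 b) => ua.
move=> /matrix0Pn[c [d]]; rewrite (ord1 c) => vd.
by apply/matrix0Pn; exists a, d; rewrite !mxE big_ord1 mulf_neq0.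
Qed.

Lemma normc_real (R : rcfType) (t : R) :
  `|real_complex R t| = real_complex R `|t|.
Proof. by rewrite normc_def /= expr0n addr0 sqrtr_sqr. Qed.

(** A rank one matrix satisfies [(u v)^2 = t (u v)] with [t = v u], so its
    eigenvalues are roots of [z^2 - t z]. *)
Lemma schur_stable_rank1 (R : rcfType) (n : nat) (u : 'cV[R]_n) (v : 'rV[R]_n) :
  `|(v *m u) 0 0| < 1 -> schur_stable (u *m v).
Proof.
set t := (v *m u) 0 0 => t1 z /eigenvalueP[x xM x0].
have MM : u *m v *m (u *m v) = t *: (u *m v).
  by rewrite mulmxA -(mulmxA u) [v *m u]mx11_scalar mul_mx_scalar scalemxAl.
have : x *m map_mx (real_complex R) (u *m v *m (u *m v)) = (z * z) *: x.
  by rewrite map_mxM mulmxA !xM -scalemxAl xM scalerA.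
rewrite MM map_mxZ -scalemxAr xM scalerA => /eqP.
rewrite -subr_eq0 -scalerBl -mulrBl scaler_eq0 (negPf x0) orbF mulf_eq0.
rewrite subr_eq0 => /orP[/eqP <-|/eqP ->]; last by rewrite normr0.
by rewrite normc_real (ltcR _ 1).
Qed.

Lemma square_mxrow_neq0 (F : fieldType) (kappa p : nat) (q : 'I_kappa -> nat)
    (hq : forall i, (0 < q i)%N) (hsq : (\sum_(i < kappa) q i)%N = p)
    (B : forall i : 'I_kappa, 'M[F]_(p, q i)) :
  square_mxrow hsq B \in unitmx -> forall i, B i != 0.
Proof.
case: p / hsq B => B; rewrite /square_mxrow castmx_id => uB i.
apply/eqP => Bi0; pose s := tagnat.Rank i (Ordinal (hq i)).
have : \mxrow_i B i *m (delta_mx s 0 : 'cV_ _) = 0.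
  rewrite -colE; apply/matrixP => a b; rewrite [LHS]mxE [RHS]mxE.
  have /matrixP/(_ a (Ordinal (hq i))) := mxrowK B i.
  by rewrite Bi0 [LHS]mxE [RHS]mxE.
move/(congr1 (mulmx (invmx (\mxrow_i B i)))); rewrite mulKmx // mulmx0.
by move/matrixP/(_ s 0)/eqP; rewrite !mxE !eqxx oner_eq0.
Qed.

Lemma is_min_le (P : pred nat) (Q : nat -> Prop) (k : nat) :
  (forall l, reflect (Q l) (P l)) -> Q k ->
  exists2 l, is_min Q l & (l <= k)%N.
Proof.
move=> PQ Qk; have exP : exists l, P l by exists k; apply/PQ.
case: (ex_minnP exP) => l Pl lmin; exists l; last by apply/lmin/PQ.
by split=> [|a Qa]; [apply/PQ | apply/lmin/PQ].
Qed.

Theorem corollary1 (R : realType) (p kappa : nat) (q m : 'I_kappa -> nat)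
    (hq : forall i : 'I_kappa, (0 < q i)%N)
    (hm : forall i : 'I_kappa, (0 < m i)%N)
    (A : 'M[R]_p)
    (B : forall i : 'I_kappa, 'M[R]_(p, q i))
    (C : forall i : 'I_kappa, 'M[R]_(m i, p))
    (hC : forall j : 'I_kappa, C j <> 0)
    (hsq : (\sum_(i < kappa) q i)%N = p)
    (hB : square_mxrow hsq B \in unitmx) :
  exists K : 'M[R]_p,
    schur_stable (A + square_mxrow hsq B *m K) /\
    forall i j : 'I_kappa,
      exists k : nat,
        is_min (fun l : nat =>
                  C j *m (A + square_mxrow hsq B *m K) ^+ l *m B i <> 0) k /\
        (k <= p - 1)%N.
Proof.
have C0 j : C j != 0 by apply/eqP/hC.
have B0 := square_mxrow_neq0 hq hB.
have [u Cu] := exists_mulmx_neq0 C0.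
have [w Bw] : exists w : 'cV_p, forall i, (B i)^T *m w != 0.
  by apply: exists_mulmx_neq0 => i; rewrite trmx_eq0.
pose v := w^T; pose t := (v *m u) 0 0; pose c := (1 + `|t|)^-1.
have t1 : 0 < 1 + `|t| by rewrite ltr_wpDr.
have vB i : v *m B i != 0 by rewrite -trmx_eq0 trmx_mul trmxK.
pose M := (c *: u) *m v.
exists (invmx (square_mxrow hsq B) *m (M - A)).
rewrite mulKVmx // addrC subrK; split.
  apply: schur_stable_rank1; rewrite -scalemxAr mxE normrM.
  by rewrite gtr0_norm ?invr_gt0 // ltr_pdivrMl // mulr1 ltrDr.
move=> i j.
have [k Qk kp] : exists2 k, C j *m M ^+ k *m B i <> 0 & (k <= p - 1)%N.
  case: (leqP p 1) => [p1|p1]; last first.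
    exists 1%N; last by rewrite subn_gt0.
    apply/eqP; rewrite expr1 /M -!scalemxAl -!scalemxAr -scalemxAl scaler_eq0.
    rewrite invr_eq0 gt_eqF //= mulmxA -(mulmxA (C j *m u)).
    exact: mulmx_col_row_neq0.
  (* Here [p = 1], so [C j] is a column and [B i] a row. *)
  exists 0%N => //; apply/eqP; rewrite expr0 mulmx1.
  have p_eq1 : p = 1%N.
    have /matrix0Pn[b _] := B0 i.
    by apply/eqP; rewrite eqn_leq p1 (leq_ltn_trans _ (ltn_ord b)).
  move: (B i) (C j) (B0 i) (C0 j); rewrite p_eq1 => Bi Cj Bi0 Cj0.
  exact: mulmx_col_row_neq0.
have [l lmin lk] := is_min_le (fun l => negPP (@eqP _ (C j *m M ^+ l *m B i) 0)) Qk.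
by exists l; split; last exact: leq_trans kp.
Qed.
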